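(* Let $r\ge 2$ and let $K_r$ be the complete graph on $r$ vertices with an arbitrary edge-ordering. Then $sat_m(n,e_0+K_r)=O(1)$.
   Context: An edge-ordered graph is a finite simple graph together with a linear order on its edge set (usually given by an injective labeling $l:E\to\mathbb{N}$ or $l:E\to\mathbb{R}$). An edge-ordered graph $H$ contains $G$ (has a copy of $G$) if $G$ is isomorphic, by an isomorphism respecting the edge-order, to a subgraph of $H$ with the induced order; otherwise $H$ is $G$-free. For an edge-ordered graph $G$, $e_0+G$ denotes the edge-ordered graph obtained from $G$ by adding a vertex-disjoint (isolated) edge $e_0$ whose label is smaller than all labels of $G$. $sat_m(n,G)$ is the minimum number of edges in a $G$-free edge-ordered graph $H$ on $n$ vertices such that adding to $H$ any missing edge, inserted at the beginning of the linear order (i.e. with a label smaller than all labels of $H$), creates a copy of $G$. Asymptotic notation is for $n\to\infty$ with the edge-ordered graph $K_r$ fixed. *)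

(* Defs.v *)
From mathcomp Require Import all_boot.
From mathcomp Require Import boolp.

Set Implicit Arguments.
Unset Strict Implicit.
Unset Printing Implicit Defensive.

(* Edges are 2-element vertex sets. The linear order on the edge set is the one
   induced by an injective labeling; values of [elab] off [edges] are junk, and
   only comparisons between labels of edges are ever used. *)
Record eograph (T : finType) := EOGraph {
  edges : {set {set T}};
  elab : {set T} -> nat;
  edges_card2 : forall e, e \in edges -> #|e| = 2;
  elab_inj : {in edges &, injective elab} }.

Definition complete (T : finType) (G : eograph T) : Prop :=
  edges G = [set e : {set T} | #|e| == 2].

(* An isomorphism of [G] onto a (not necessarily induced) subgraph of [H] that
   respects the edge-orders. *)
Definition is_copy (T U : finType) (H : eograph T) (G : eograph U)
    (phi : U -> T) : Prop :=
  [/\ injective phi,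
      forall e, e \in edges G -> phi @: e \in edges H &
      forall e e', e \in edges G -> e' \in edges G ->
        (elab H (phi @: e) < elab H (phi @: e')) = (elab G e < elab G e')].

Definition contains (T U : finType) (H : eograph T) (G : eograph U) : Prop :=
  exists phi : U -> T, is_copy H G phi.

Section AddFirst.
Variables (T : finType) (H : eograph T) (f : {set T}) (f2 : #|f| = 2).

(* Labels are shifted by one so that 0 is free for [f]. *)
Let lab (e : {set T}) : nat := if e == f then 0 else (elab H e).+1.

Fact add_first_card2 e : e \in f |: edges H -> #|e| = 2.
Proof. by rewrite !inE => /orP[/eqP->|/edges_card2]. Qed.

Fact add_first_inj : {in f |: edges H &, injective lab}.
Proof.
move=> x y; rewrite !inE /lab.
case: (eqVneq x f) => [->|_] /=; case: (eqVneq y f) => [->|_] //= xH yH [].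
exact: elab_inj.
Qed.

Definition add_first : eograph T := EOGraph add_first_card2 add_first_inj.
End AddFirst.

Section E0Plus.
Variables (U : finType) (G : eograph U).

Let lab (e : {set U + bool}) : nat := elab G (@inl U bool @^-1: e).

Let inlK (e : {set U}) : @inl U bool @^-1: (@inl U bool @: e) = e.
Proof. by apply/setP=> x; rewrite inE mem_imset //; move=> ? ? []. Qed.

Fact pad_card2 e :
  e \in [set @inl U bool @: d | d : {set U} in edges G] -> #|e| = 2.
Proof.
by move=> /imsetP[d dG ->]; rewrite card_imset ?(edges_card2 dG) // => ? ? [].
Qed.

Fact pad_inj :
  {in [set @inl U bool @: d | d : {set U} in edges G] &, injective lab}.
Proof.
move=> _ _ /imsetP[d dG ->] /imsetP[d' dG' ->]; rewrite /lab !inlK.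
by move=> /(elab_inj dG dG') ->.
Qed.

(* [G] with two extra isolated vertices [inr false] and [inr true]. *)
Definition pad : eograph (U + bool)%type := EOGraph pad_card2 pad_inj.

Fact e0_card2 : #|[set @inr U bool false; inr true]| = 2.
Proof. by rewrite cards2. Qed.

Definition e0_plus : eograph (U + bool)%type := add_first pad e0_card2.
End E0Plus.

Definition saturated (n : nat) (U : finType) (G : eograph U)
    (H : eograph 'I_n) : Prop :=
  ~ contains H G /\
  forall (f : {set 'I_n}) (f2 : #|f| = 2),
    f \notin edges H -> contains (add_first H f2) G.

Definition sat_size (n : nat) (U : finType) (G : eograph U) : pred nat :=
  fun k => `[< exists2 H : eograph 'I_n, saturated G H & #|edges H| = k >].

(* The default 0 is used only if no saturated graph exists; by [sat_mP] this
   requires [G] to be edgeless. *)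
Definition sat_m (n : nat) (U : finType) (G : eograph U) : nat :=
  match pselect (exists k, sat_size n G k) with
  | left ex => ex_minn ex
  | right _ => 0
  end.

Lemma sat_size_ex (n : nat) (U : finType) (G : eograph U) :
  edges G != set0 -> exists k, sat_size n G k.
Proof.
move=> /set0Pn[e eG].
pose free k := `[< exists2 H : eograph 'I_n, ~ contains H G & #|edges H| = k >].
have ex_free : exists k, free k.
  have c0 (d : {set 'I_n}) : d \in set0 -> #|d| = 2 by rewrite inE.
  have i0 : {in set0 &, injective (fun _ : {set 'I_n} => 0)}.
    by move=> x y; rewrite inE.
  exists 0; apply/asboolP; exists (EOGraph c0 i0); last by rewrite cards0.
  by move=> [phi [_ /(_ _ eG)]]; rewrite inE.
have ub k : free k -> k <= #|{set 'I_n}|.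
  by move=> /asboolP[H _ <-]; exact: max_card.
case: (ex_maxnP ex_free ub) => k /asboolP[H Hfree Hk] kmax.
exists k; apply/asboolP; exists H => //; split=> // f f2 fH.
apply: contrapT => nc; have : free k.+1.
  by apply/asboolP; exists (add_first H f2); rewrite //= cardsU1 fH Hk.
by move=> /kmax; rewrite ltnn.
Qed.

Lemma sat_mP (n : nat) (U : finType) (G : eograph U) :
  edges G != set0 ->
  (exists2 H : eograph 'I_n, saturated G H & #|edges H| = sat_m n G) /\
  (forall H : eograph 'I_n, saturated G H -> sat_m n G <= #|edges H|).
Proof.
move=> /(sat_size_ex n) ex; rewrite /sat_m; case: pselect => // ex'.
case: ex_minnP => k /asboolP kP kmin; split=> // H Hsat.
by apply: kmin; apply/asboolP; exists H.
Qed.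

(* Main.v *)
Require Import Defs.
From mathcomp Require Import all_boot.
From mathcomp Require Import boolp zify.

Set Implicit Arguments.
Unset Strict Implicit.
Unset Printing Implicit Defensive.

(** Glue three copies of [K_r] along a triangle, the [i]-th copy having its
    smallest edge on the triangle edge opposite to corner [i], and let the
    triangle edges precede all other edges. An [r]-clique meets at most one of
    the three remainders, of size [r - 2], so it contains a triangle edge; any
    smaller edge is a triangle edge too, hence is not disjoint from the clique:
    the graph is [e_0 + K_r]-free. No vertex lies in all three copies, so a new
    first edge with an isolated endpoint is disjoint from one of the copies.
    Hence adding first edges greedily, without creating [e_0 + K_r], never leaves
    the [3 + 3 (r - 2)] original vertices. *)

(** * Copies of [e0_plus] as copies of the graph with a smaller disjoint edge *)

Lemma inl_preimsetK (U : finType) (e : {set U}) :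
  @inl U bool @^-1: (@inl U bool @: e) = e.
Proof. by apply/setP=> x; rewrite inE mem_imset //; move=> ? ? []. Qed.

Lemma complete_pair (U : finType) (K : eograph U) (x y : U) :
  complete K -> x != y -> [set x; y] \in edges K.
Proof. by move=> -> xy; rewrite inE cards2 xy. Qed.

Lemma imset_inl_neq_e0 (U : finType) (d : {set U}) :
  (@inl U bool @: d == [set inr false; inr true]) = false.
Proof.
apply/eqP=> /setP/(_ (inr false)); rewrite !inE eqxx /=.
by move/imsetP=> [].
Qed.

Lemma elab_e0_plus_inl (U : finType) (G : eograph U) (d : {set U}) :
  elab (e0_plus G) (inl @: d) = (elab G d).+1.
Proof. by rewrite /= imset_inl_neq_e0 inl_preimsetK. Qed.

Lemma elab_e0_plus_e0 (U : finType) (G : eograph U) :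
  elab (e0_plus G) [set inr false; inr true] = 0.
Proof. by rewrite /= eqxx. Qed.

Lemma edges_e0_plusP (U : finType) (G : eograph U) (e : {set U + bool}) :
  e \in edges (e0_plus G) <->
  e = [set inr false; inr true] \/ exists2 d, d \in edges G & e = inl @: d.
Proof.
rewrite !inE; split=> [/orP[/eqP|/imsetP[d]]|[->|[d dG ->]]].
- by left.
- by right; exists d.
- by rewrite eqxx.
- by rewrite imset_f ?orbT.
Qed.

Lemma is_copy_add_first (T U : finType) (H : eograph T) (G : eograph U)
    (f : {set T}) (f2 : #|f| = 2) (phi : U -> T) :
  f \notin edges H -> is_copy H G phi -> is_copy (add_first H f2) G phi.
Proof.
move=> fH [inj emap ord].
have neq e : e \in edges G -> (phi @: e == f) = false.
  by move=> /emap eH; apply: contraNF fH => /eqP <-.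
split=> // [e /emap eH|e e' eG e'G]; first by rewrite !inE eH orbT.
by rewrite /= !neq // ltnS ord.
Qed.

(** The new edge [f] comes first and misses the copy [phi], so it can serve as the image of
    $e_0$. *)
Lemma add_first_contains_e0_plus (T U : finType) (H : eograph T)
    (G : eograph U) (f : {set T}) (f2 : #|f| = 2) (phi : U -> T) :
  f \notin edges H -> is_copy H G phi -> (forall x, phi x \notin f) ->
  contains (add_first H f2) (e0_plus G).
Proof.
move=> fH [inj emap ord] disj.
have /eqP/cards2P[u [v [uv fE]]] := f2.
have neq e : e \in edges G -> (phi @: e == f) = false.
  by move=> /emap eH; apply: contraNF fH => /eqP <-.
pose psi (z : U + bool) :=
  match z with inl x => phi x | inr b => if b then v else u end.
have psil (d : {set U}) : psi @: (inl @: d) = phi @: d by rewrite -imset_comp.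
have psir : psi @: [set inr false; inr true] = f by rewrite imsetU1 imset_set1.
exists psi; split.
- have phiu x : phi x <> u.
    by move=> xu; move: (disj x); rewrite fE xu !inE eqxx.
  have phiv x : phi x <> v.
    by move=> xv; move: (disj x); rewrite fE xv !inE eqxx orbT.
  move=> [x|[]] [y|[]] //= => [/inj->//|/phiv|/phiu|/esym/phiv|E|/esym/phiu|E] //.
    by rewrite E eqxx in uv.
  by rewrite E eqxx in uv.
- move=> e /edges_e0_plusP[->|[d dG ->]]; rewrite ?psir ?psil !inE ?eqxx //.
  by rewrite emap ?orbT.
- move=> e e' /edges_e0_plusP[->|[d dG ->]] /edges_e0_plusP[->|[d' d'G ->]];
    rewrite ?psir ?psil ?elab_e0_plus_e0 ?elab_e0_plus_inl /= ?eqxx ?neq //.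
  by rewrite !ltnS ord.
Qed.

(** The edge [g] is the image of $e_0$. *)
Lemma contains_e0_plus (T U : finType) (H : eograph T) (G : eograph U) :
  contains H (e0_plus G) ->
  exists phi g, [/\ is_copy H G phi, g \in edges H,
    forall x, phi x \notin g &
    forall d, d \in edges G -> elab H g < elab H (phi @: d)].
Proof.
move=> [psi [inj emap ord]].
have e0E : [set inr false; inr true] \in edges (e0_plus G).
  by apply/edges_e0_plusP; left.
have inlE d : d \in edges G -> inl @: d \in edges (e0_plus G).
  by move=> dG; apply/edges_e0_plusP; right; exists d.
exists (psi \o inl), (psi @: [set inr false; inr true]); split.
- split=> [x y /inj[]//|e eG|e e' eG e'G].
    by rewrite imset_comp; apply: emap; exact: inlE.
  by rewrite !(imset_comp psi inl) ord ?inlE // !elab_e0_plus_inl.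
- exact: emap.
- by move=> x; apply/imsetP=> -[z zE /= /inj zx]; rewrite -zx !inE in zE.
- move=> d dG; rewrite imset_comp ord ?inlE //.
  by rewrite elab_e0_plus_e0 elab_e0_plus_inl.
Qed.

(** * Saturating a seed graph inside a fixed vertex set *)

(** Greedy addition is replaced by a graph [M] with the most edges among those satisfying the three
    hypotheses on [H]. Such an [M] is saturated, and its edges are subsets of [S], whence the crude
    bound. *)
Lemma sat_m_e0_plus_le (n : nat) (U : finType) (K : eograph U)
    (H : eograph 'I_n) (S : {set 'I_n}) :
  complete K -> 1 < #|U| ->
  ~ contains H (e0_plus K) -> (forall e, e \in edges H -> e \subset S) ->
  (forall v, exists2 phi, is_copy H K phi & forall x, phi x != v) ->
  sat_m n (e0_plus K) <= 2 ^ #|S|.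
Proof.
move=> hK U_gt1 Hfree HS Hav.
pose good (H' : eograph 'I_n) := [/\ ~ contains H' (e0_plus K),
  forall e, e \in edges H' -> e \subset S &
  forall v, exists2 phi, is_copy H' K phi & forall x, phi x != v].
pose P k := `[< exists2 H', good H' & #|edges H'| = k >].
have le_good H' : good H' -> #|edges H'| <= 2 ^ #|S|.
  move=> [_ HS' _]; rewrite -card_powerset; apply: subset_leq_card.
  by apply/subsetP=> e /HS'; rewrite inE.
have exP : exists k, P k by exists #|edges H|; apply/asboolP; exists H.
have ubP k : P k -> k <= 2 ^ #|S| by move=> /asboolP[H' /le_good + <-].
case: (ex_maxnP exP ubP) => _ /asboolP[M Mgood <-] Mmax.
apply: leq_trans (le_good _ Mgood).
have [Mfree MS Mav] := Mgood.
have e0E : edges (e0_plus K) != set0.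
  by apply/set0Pn; eexists; apply/edges_e0_plusP; left.
apply: (sat_mP n e0E).2; split=> // f f2 fM.
have [fS|] := boolP (f \subset S).
  apply: contrapT => nc; have /Mmax : P #|edges M|.+1.
    apply/asboolP; exists (add_first M f2); last by rewrite /= cardsU1 fM.
    split=> // [e|v]; first by rewrite !inE => /orP[/eqP->|/MS].
    by have [phi ? ?] := Mav v; exists phi => //; exact: is_copy_add_first.
  by rewrite ltnn.
(* If [f] leaves [S] at [u], a copy avoiding the other end [v] also avoids [u]: every vertex of [K]
   lies on an edge, so the copy stays inside [S]. *)
move=> /subsetPn[u uf uS].
have [v fE] : exists v, f = [set u; v].
  have /eqP/cards2P[a [b [_ fE]]] := f2.
  move: uf; rewrite fE !inE => /orP[]/eqP->; first by exists b.
  by exists a; rewrite setUC.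
have [phi phiM phiv] := Mav v.
apply: (add_first_contains_e0_plus f2 fM phiM) => x.
rewrite fE !inE negb_or phiv andbT; apply: contraNneq uS => <-.
have [y xy] : exists y, x != y.
  have /card_gt0P[y] : 0 < #|[set~ x]| by rewrite cardsC1; lia.
  by rewrite !inE eq_sym; exists y.
have [_ emap _] := phiM.
apply: (subsetP (MS _ (emap _ (complete_pair hK xy)))).
by rewrite imset_f // !inE eqxx.
Qed.

(** * Union of several copies of one edge-ordered graph *)

Section Gluing.
Variables (T U : finType) (k : nat) (K : eograph U) (phi : 'I_k -> U -> T).
Hypothesis phi_inj : forall i, injective (phi i).

Definition glue_edges : {set {set T}} :=
  [set phi x.1 @: x.2 | x : 'I_k * {set U} & x.2 \in edges K].

(* The copy index, as last base-[k] digit, breaks ties between copies of one edge. *)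
Definition glue_lab (e : {set T}) : nat :=
  if [pick x : 'I_k * {set U} | (x.2 \in edges K) && (e == phi x.1 @: x.2)]
    is Some x then elab K x.2 * k + x.1 else 0.

Lemma glue_edgesP (e : {set T}) :
  reflect (exists i d, d \in edges K /\ e = phi i @: d) (e \in glue_edges).
Proof.
apply: (iffP imsetP) => [[[i d] dK ->]|[i [d [dK ->]]]].
  by rewrite inE in dK; exists i, d.
by exists (i, d) => //; rewrite inE.
Qed.

Fact glue_card2 e : e \in glue_edges -> #|e| = 2.
Proof.
by move=> /glue_edgesP[i [d [dK ->]]]; rewrite card_imset ?(edges_card2 dK).
Qed.

Lemma glue_lab_digits (a b : nat) (i j : 'I_k) :
  a * k + i = b * k + j -> a = b /\ i = j.
Proof.
move=> E; have k_gt0 : 0 < k by case: (i) => m; case: (k).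
have ab : a = b.
  move/(congr1 (divn^~ k)): E.
  by rewrite !divnMDl // !divn_small // !addn0.
by split=> //; apply: val_inj => /=; move: E; rewrite ab => /addnI.
Qed.

(** The label encodes the picked pair in base [k], and this pair determines the edge. *)
Fact glue_inj : {in glue_edges &, injective glue_lab}.
Proof.
move=> e e' /glue_edgesP[i [d [dK ->]]] /glue_edgesP[i' [d' [d'K ->]]].
rewrite /glue_lab.
case: pickP => [[j c] /andP[/= cK /eqP->]|/(_ (i, d))]; last by rewrite /= dK eqxx.
case: pickP => [[j' c'] /andP[/= c'K /eqP->]|/(_ (i', d'))]; last first.
  by rewrite /= d'K eqxx.
by move=> /glue_lab_digits[/(elab_inj cK c'K)-> ->].
Qed.

Definition glue : eograph T := EOGraph glue_card2 glue_inj.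

Hypothesis phi_disj : forall i j d d', d \in edges K -> d' \in edges K ->
  phi i @: d = phi j @: d' -> i = j.

(** Edge-disjointness forces the picked index to be [i]; injectivity of [phi i] then forces the
    picked edge to be [d]. *)
Lemma elab_glue i d : d \in edges K ->
  elab glue (phi i @: d) = elab K d * k + i.
Proof.
move=> dK; rewrite /= /glue_lab.
case: pickP => [[j c] /andP[/= cK /eqP E]|/(_ (i, d))]; last by rewrite /= dK eqxx.
have ij := phi_disj dK cK E; rewrite -ij in E *.
by rewrite (imset_inj (@phi_inj i) E).
Qed.

Lemma glue_copy i : is_copy glue K (phi i).
Proof.
split=> // [d dK|d d' dK d'K]; first by apply/glue_edgesP; exists i, d.
rewrite !elab_glue // ltn_add2r ltn_mul2r.
by have -> : 0 < k by case: (i) => m; case: (k).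
Qed.
End Gluing.

(** * Three petals on a common triangle *)

Section TriangleGluing.
Variables (T U : finType) (K : eograph U) (p q : U).
Variable iota : 'I_3 + 'I_3 * U -> T.
Hypothesis iota_inj : injective iota.
Hypothesis hK : complete K.
Hypothesis pq : p != q.
Hypothesis pq_min : forall d, d \in edges K -> elab K [set p; q] <= elab K d.

(* The vertices [inr (i, p)] and [inr (i, q)] belong to no petal: they are isolated
   padding. *)
Definition petal (i : 'I_3) (u : U) : 'I_3 + 'I_3 * U :=
  if u == p then inl (lift i ord0)
  else if u == q then inl (lift i ord_max) else inr (i, u).

(** [lift i] skips [i], so petal [i] lays [[set p; q]] on the side opposite corner [i]. *)
Lemma petal_inl i u c : petal i u = inl c -> u \in [set p; q] /\ c != i.
Proof.
rewrite /petal !inE; case: eqP => _; last case: eqP => _ //.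
all: by case=> <-; split; rewrite ?orbT // eq_sym neq_lift.
Qed.

Lemma petal_inr i u x : petal i u = inr x ->
  x = (i, u) /\ u \notin [set p; q].
Proof. by rewrite /petal !inE; do 2![case: eqP => // _] => -[<-]. Qed.

Lemma petal_inj i : injective (petal i).
Proof.
have inl_neq : inl (lift i ord0) <> inl (lift i ord_max) :> 'I_3 + 'I_3 * U.
  by case; rewrite /bump; lia.
move=> u v; rewrite /petal.
case: (u =P p) => [->|_] /=; case: (v =P p) => [->|_] //=.
- by case: eqP => // _ /inl_neq.
- by case: eqP => // _ /esym/inl_neq.
- case: (u =P q) => [->|_] /=; case: (v =P q) => [->|_] //=.
  by case.
Qed.

(** Petals are edge-disjoint: an outer vertex carries its petal index, and two distinct corners
    leave a single index in ['I_3] different from both. *)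
Lemma petal_meet (i j : 'I_3) (u v u' v' : U) : u != v ->
  petal i u = petal j u' -> petal i v = petal j v' -> i = j.
Proof.
move=> uv.
case Eu: (petal i u) => [a|x] Eu'; last first.
  by have [+ _] := petal_inr (esym Eu'); have [-> _] := petal_inr Eu; case.
case Ev: (petal i v) => [b|x] Ev'; last first.
  by have [+ _] := petal_inr (esym Ev'); have [-> _] := petal_inr Ev; case.
have ab : a != b.
  by apply: contraNneq uv => ab; apply/eqP/(@petal_inj i); rewrite Eu Ev ab.
have [_ ai] := petal_inl Eu; have [_ bi] := petal_inl Ev.
have [_ aj] := petal_inl (esym Eu'); have [_ bj] := petal_inl (esym Ev').
apply: val_inj; move: ab ai bi aj bj; rewrite -!val_eqE /=.
have := (ltn_ord a, ltn_ord b, ltn_ord i, ltn_ord j).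
by case; case; case; lia.
Qed.

Let leaf i u := iota (petal i u).

Lemma leaf_inj i : injective (leaf i).
Proof. by move=> u v /iota_inj/petal_inj. Qed.

Lemma leaf_disj i j d d' : d \in edges K -> d' \in edges K ->
  leaf i @: d = leaf j @: d' -> i = j.
Proof.
move=> /edges_card2/eqP/cards2P[u [v [uv ->]]] _ E.
have /imsetP[u' _ /iota_inj Eu] : leaf i u \in leaf j @: d'.
  by rewrite -E imset_f // !inE eqxx.
have /imsetP[v' _ /iota_inj Ev] : leaf i v \in leaf j @: d'.
  by rewrite -E imset_f // !inE eqxx orbT.
exact: petal_meet uv Eu Ev.
Qed.

Definition trefoil : eograph T := glue K leaf_inj.

Lemma trefoil_copy i : is_copy trefoil K (leaf i).
Proof. exact: glue_copy leaf_disj i. Qed.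

(** Petal [c] misses corner [c], an outer vertex lies in at most one petal, and a vertex outside the
    range of [iota] lies in none. *)
Lemma trefoil_avoid v :
  exists2 psi, is_copy trefoil K psi & forall x, psi x != v.
Proof.
have [[[c|[i w]] Ev]|nv] := pselect (exists z, v = iota z).
- exists (leaf c) => [|x]; first exact: trefoil_copy.
  apply/eqP; rewrite Ev => /iota_inj/petal_inl[_].
  by rewrite eqxx.
- exists (leaf (lift i ord0)) => [|x]; first exact: trefoil_copy.
  apply/eqP; rewrite Ev => /iota_inj/petal_inr[[/eqP]].
  by rewrite (negbTE (neq_lift _ _)).
- exists (leaf ord0) => [|x]; first exact: trefoil_copy.
  by apply/eqP=> E; apply: nv; exists (petal ord0 x).
Qed.

Lemma trefoil_sub e : e \in edges trefoil -> e \subset iota @: setT.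
Proof.
move=> /glue_edgesP[i [d [_ ->]]].
by apply/subsetP=> _ /imsetP[u _ ->]; exact: (imset_f iota).
Qed.

Lemma trefoil_adj (psi : U -> T) x y : is_copy trefoil K psi -> x != y ->
  exists i u v, [/\ u != v, [set psi x; psi y] = leaf i @: [set u; v],
    psi x = leaf i u & psi y = leaf i v].
Proof.
move=> [inj emap _] xy.
have /emap/glue_edgesP[i [d [dK E]]] := complete_pair hK xy.
have Exy : [set psi x; psi y] = leaf i @: d by rewrite -E imsetU1 imset_set1.
have /imsetP[u ud Eu] : psi x \in leaf i @: d by rewrite -Exy !inE eqxx.
have /imsetP[v vd Ev] : psi y \in leaf i @: d by rewrite -Exy !inE eqxx orbT.
have uv : u != v by apply: contraNneq xy => uv; apply/eqP/inj; rewrite Eu Ev uv.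
by exists i, u, v; split=> //; rewrite imsetU1 imset_set1 -Eu -Ev.
Qed.

(** Non-corner vertices of the copy pairwise share a petal, so their coordinates in [U], which avoid
    [p] and [q], are distinct. There are at most [#|U| - 2] of them, which leaves two corners. *)
Lemma trefoil_clique (psi : U -> T) : is_copy trefoil K psi ->
  exists x y a b, [/\ x != y, psi x = iota (inl a) & psi y = iota (inl b)].
Proof.
move=> psiP; have inj : injective psi by case: psiP.
pose A := [set x | [exists a, psi x == iota (inl a)]].
have [/card_gt1P[x [y]]|A_le1] := ltnP 1 #|A|.
  rewrite !inE => -[/existsP[a /eqP Ea] /existsP[b /eqP Eb] xy].
  by exists x, y, a, b.
have nbr (x : U) : exists y, x != y.
  case: (eqVneq x p) => [->|]; first by exists q.
  by exists p.
have outer x : x \in ~: A ->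
    exists i w, psi x = iota (inr (i, w)) /\ w \notin [set p; q].
  rewrite !inE => /existsPn xA.
  have [y /(trefoil_adj psiP)[i [u [v [_ _ Ex _]]]]] := nbr x.
  case Eu: (petal i u) => [a|z]; first by case/eqP: (xA a); rewrite Ex /leaf Eu.
  by have [Ez ?] := petal_inr Eu; exists i, u; rewrite Ex /leaf Eu Ez.
(* The coordinate of an outer vertex; the default [x] is only reached on [A]. *)
pose w x := odflt x [pick w | [exists i, psi x == iota (inr (i, w))]].
have wE x i v : psi x = iota (inr (i, v)) -> w x = v.
  rewrite /w => Ex; case: pickP => [v' /existsP[j /eqP]|/(_ v)/existsP[]].
    by rewrite Ex => /iota_inj[].
  by exists i; rewrite Ex.
have w_inj : {in ~: A &, injective w}.
  move=> x y /outer[i [u [Ex _]]] /outer[j [v [Ey _]]].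
  rewrite (wE _ _ _ Ex) (wE _ _ _ Ey) => uv; subst v.
  (* Distinct [x] and [y] would be adjacent, hence in one petal, where equal coordinates give equal
     images. *)
  apply/eqP/contraT => xy; have [l [a [b [_ _]]]] := trefoil_adj psiP xy.
  rewrite Ex Ey => /iota_inj/esym/petal_inr[[Ei _] _].
  move=> /iota_inj/esym/petal_inr[[Ej _] _].
  by case/eqP: xy; apply: inj; rewrite Ex Ey Ei Ej.
have : #|~: A| <= #|~: [set p; q]|.
  rewrite -(card_in_imset w_inj); apply: subset_leq_card.
  apply/subsetP=> _ /imsetP[x /outer[i [v [Ex vpq]]] ->].
  by rewrite (wE _ _ _ Ex) inE.
have := cardsC A; have := cardsC [set p; q]; rewrite cards2 pq; lia.
Qed.

(** The copy contains a triangle side, whose label comes from the smallest edge of [K]. An edge [g]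
    below it is again a side, opposite some corner [j]; the two corners in the copy avoid [g], so
    both would be [j]. *)
Lemma trefoil_free : ~ contains trefoil (e0_plus K).
Proof.
move=> /contains_e0_plus[psi [g [psiP gE disj lt_g]]].
have [x [y [a [b [xy Ea Eb]]]]] := trefoil_clique psiP.
have pqK : [set p; q] \in edges K by exact: complete_pair.
have ab : a != b.
  case: psiP => inj _ _; apply: contraNneq xy => ab.
  by apply/eqP/inj; rewrite Ea Eb ab.
have [i [u [v [uv Exy Ex Ey]]]] := trefoil_adj psiP xy.
have [upq _] : u \in [set p; q] /\ a != i.
  by apply: petal_inl; apply: iota_inj; rewrite -Ea Ex.
have [vpq _] : v \in [set p; q] /\ b != i.
  by apply: petal_inl; apply: iota_inj; rewrite -Eb Ey.
have uvE : [set u; v] = [set p; q].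
  apply/eqP; rewrite eqEcard !cards2 uv pq leqnn andbT.
  by apply/subsetP=> z; rewrite !inE => /orP[]/eqP->; rewrite -!in_set2.
have /glue_edgesP[j [d [dK gd]]] := gE.
have := lt_g _ (complete_pair hK xy).
rewrite imsetU1 imset_set1 Exy uvE gd !(elab_glue leaf_inj leaf_disj) // => lt.
(* The digit [i] is below the base 3, so the smaller label gives [elab K d <= elab K [set p; q]]. *)
have dE : d = [set p; q].
  apply: (elab_inj dK pqK); apply/eqP; rewrite eqn_leq pq_min // andbT.
  by have := ltn_ord i; lia.
have corner z c : psi z = iota (inl c) -> c = j.
  move=> Ec; case: (unliftP j c) => // k ck; have := disj z.
  rewrite Ec gd dE imsetU1 imset_set1 !inE /leaf /petal eqxx.
  rewrite (eq_sym q) (negbTE pq) eqxx !(inj_eq iota_inj) ck.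
  case: k {ck} => [[|[|//]]] lt_k; case/norP=> /eqP n0 /eqP n1.
    by case: n0; congr (inl (lift _ _)); apply: val_inj.
  by case: n1; congr (inl (lift _ _)); apply: val_inj.
by rewrite (corner _ _ Ea) (corner _ _ Eb) eqxx in ab.
Qed.
End TriangleGluing.

Theorem corollary44 (r : nat) (hr : 2 <= r) (K : eograph 'I_r)
    (hK : complete K) :
  exists C N : nat, forall n : nat, N <= n -> sat_m n (e0_plus K) <= C.
Proof.
pose V : finType := ('I_3 + 'I_3 * 'I_r)%type.
(* The threshold lets [V] embed in ['I_n]; the exponent is the size of the image, which serves as
   [S]. *)
exists (2 ^ #|V|), #|V| => n Vn.
pose iota (z : V) : 'I_n := widen_ord Vn (enum_rank z).
have iota_inj : injective iota.
  by move=> x y /(congr1 val)/= /val_inj/enum_rank_inj.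
(* Since $r \ge 2$ there is an edge, hence a smallest one to lay on the triangle. *)
have zK : [set Ordinal (ltnW hr); Ordinal hr] \in edges K.
  exact: complete_pair.
have [d dK dmin] := arg_minnP (elab K) zK.
have /eqP/cards2P[p [q [pq dE]]] := edges_card2 dK.
rewrite dE in dmin.
rewrite -cardsT -(card_imset setT iota_inj).
apply: (@sat_m_e0_plus_le n _ K (trefoil K iota_inj pq)) => //.
- by rewrite card_ord.
- exact: trefoil_free.
- exact: trefoil_sub.
- exact: trefoil_avoid.
Qed.
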